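(* Let $\mathcal{A}$ be a hypersolvable central arrangement in $\mathbb{K}^\ell$ with solvable filtration $\emptyset=\mathcal{A}_0\subset\mathcal{A}_1\subset\cdots\subset\mathcal{A}_k=\mathcal{A}$ and hyperexponents $(b_1,\dots,b_k)$, $b_i=|\mathcal{A}_i\setminus\mathcal{A}_{i-1}|$. Let $H\in\mathcal{A}\setminus\mathcal{A}_{k-1}$, put $\mathcal{A}'=\mathcal{A}\setminus\{H\}$, let $d_{\mathcal{A}'}$ and $d_{\mathcal{A}}$ be the maximal degrees of elements of minimal homogeneous generating sets of $D(\mathcal{A}')$ and $D(\mathcal{A})$, and let $\rho(\mathcal{A})=\max\{b_i\mid i=1,\dots,k\}$. Then $d_{\mathcal{A}'}\ge\rho(\mathcal{A})-1$ and $d_{\mathcal{A}}\ge\rho(\mathcal{A})-1$.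
   Context: $\mathbb{K}$ is a field of characteristic zero, $S=\mathbb{K}[x_1,\dots,x_\ell]$; $D(\mathcal{A})=\{\theta\in\mathrm{Der}(S)\mid\theta(Q(\mathcal{A}))\in Q(\mathcal{A})S\}$ with $Q(\mathcal{A})=\prod\alpha_H$. For hyperplanes $H_1,\dots,H_k$, $\mathrm{rank}(H_1,\dots,H_k)=\mathrm{codim}(\bigcap_jH_j)$. For arrangements $\mathcal{B}\subseteq\mathcal{C}$ with $\bar{\mathcal{B}}=\mathcal{C}\setminus\mathcal{B}$, $\mathcal{B}$ is solvable in $\mathcal{C}$ if: (1) for all distinct $\alpha,\beta\in\mathcal{B}$ and all $a\in\bar{\mathcal{B}}$, $\mathrm{rank}(\alpha,\beta,a)=3$; (2) for all distinct $a,b\in\bar{\mathcal{B}}$ there is $\alpha\in\mathcal{B}$ with $\mathrm{rank}(a,b,\alpha)=2$ (unique by (1); denote it $f(a,b)$); (3) for all distinct $a,b,c\in\bar{\mathcal{B}}$, $\mathrm{rank}(f(a,b),f(a,c),f(b,c))\in\{1,2\}$. $\mathcal{A}$ is hypersolvable if there is a chain $\emptyset=\mathcal{A}_0\subset\mathcal{A}_1\subset\cdots\subset\mathcal{A}_k=\mathcal{A}$ (a solvable filtration) with $\mathcal{A}_i$ solvable in $\mathcal{A}_{i+1}$ for all $i=1,\dots,k-1$; the hyperexponents are $b_i=|\mathcal{A}_i\setminus\mathcal{A}_{i-1}|$.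
   Formalization: The solvable filtration is required to start with a single hyperplane, |A_1| = 1 (standard definition); without this the claim fails, e.g. for k = 1 and A = A_1 the Boolean arrangement in K^3, where ρ(A) = 3 but d_A = 1. *)

(* Defs.v *)
From HB Require Import structures.
From mathcomp Require Import all_boot all_order all_algebra.
From mathcomp Require Import mpoly.

Set Implicit Arguments.
Unset Strict Implicit.
Unset Printing Implicit Defensive.

Import GRing.Theory.

Local Open Scope ring_scope.

Section Arrangement.

Context {K : fieldType} {l : nat} {I : finType}.

Definition hyperplane (a : 'rV[K]_l) : {vspace 'rV[K]_l} :=
  lker (linfun (mulmxr a^T : 'rV[K]_l -> 'rV[K]_1)).

Definition linear_form (a : 'rV[K]_l) : {mpoly K[l]} :=
  \sum_(i < l) a 0 i *: 'X_i.

(* A finite central arrangement is given by an indexing type I for its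
   hyperplanes and a choice, for each of them, of a defining form; its
   subarrangements are the elements of {set I}. *)
Definition is_arrangement (alpha : I -> 'rV[K]_l) : Prop :=
  (forall i, alpha i != 0) /\ injective (fun i => hyperplane (alpha i)).

Definition arr_rank (alpha : I -> 'rV[K]_l) (J : {set I}) : nat :=
  (l - \dim (\bigcap_(i in J) hyperplane (alpha i))%VS)%N.

(* [codep alpha B a b x]: x is a value f(a,b) of the partial function f of the
   definition of solvability (x is unique since any two elements of B have
   rank 3 with any hyperplane outside B). *)
Definition codep (alpha : I -> 'rV[K]_l) (B : {set I}) (a b x : I) : Prop :=
  x \in B /\ arr_rank alpha [set a; b; x] = 2%N.

Definition solvable_in (alpha : I -> 'rV[K]_l) (B C : {set I}) : Prop :=
  [/\ B \subset C,
      forall x y a, x \in B -> y \in B -> x != y -> a \in C :\: B ->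
        arr_rank alpha [set x; y; a] = 3%N,
      forall a b, a \in C :\: B -> b \in C :\: B -> a != b ->
        exists x, codep alpha B a b x
    & forall a b c, a \in C :\: B -> b \in C :\: B -> c \in C :\: B ->
        a != b -> a != c -> b != c ->
        forall x y z, codep alpha B a b x -> codep alpha B a c y ->
          codep alpha B b c z ->
        arr_rank alpha [set x; y; z] = 1%N \/ arr_rank alpha [set x; y; z] = 2%N].

(* The condition #|F 1| = 1 (rank one start, as in Jambu and Papadima) amounts
   to asking that F 0 = set0 be solvable in F 1. Without it the one-step chain
   would make every arrangement hypersolvable. *)
Definition solvable_filtration (alpha : I -> 'rV[K]_l) (k : nat)
    (F : nat -> {set I}) : Prop :=
  [/\ F 0%N = set0,
      F k = [set: I],
      forall i, (i < k)%N -> F i \proper F i.+1,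
      (0 < k)%N -> #|F 1%N| = 1%N
    & forall i, (0 < i < k)%N -> solvable_in alpha (F i) (F i.+1)].

Definition hyperexponent (F : nat -> {set I}) (i : nat) : nat :=
  #|F i :\: F i.-1|.

Definition max_hyperexponent (k : nat) (F : nat -> {set I}) : nat :=
  \max_(1 <= i < k.+1) hyperexponent F i.

Definition derivation (theta : {mpoly K[l]} -> {mpoly K[l]}) : Prop :=
  linear theta /\ forall p q, theta (p * q) = theta p * q + p * theta q.

Definition defining_poly (alpha : I -> 'rV[K]_l) (B : {set I}) : {mpoly K[l]} :=
  \prod_(i in B) linear_form (alpha i).

Definition log_derivation (alpha : I -> 'rV[K]_l) (B : {set I})
    (theta : {mpoly K[l]} -> {mpoly K[l]}) : Prop :=
  derivation theta /\
  exists g, theta (defining_poly alpha B) = g * defining_poly alpha B.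

(* Polynomial degree: theta = \sum_i theta 'X_i * d/dX_i has degree d when the
   coefficients theta 'X_i are homogeneous of degree d; in particular the Euler
   derivation has degree 1. *)
Definition homog_derivation (d : nat)
    (theta : {mpoly K[l]} -> {mpoly K[l]}) : Prop :=
  derivation theta /\ forall i : 'I_l, theta 'X_i \is d.-homog.

Definition der_degree (theta : {mpoly K[l]} -> {mpoly K[l]}) : nat :=
  \max_(i < l) (msize (theta 'X_i)).-1.

Definition generates_log_der (alpha : I -> 'rV[K]_l) (B : {set I}) (m : nat)
    (G : 'I_m -> {mpoly K[l]} -> {mpoly K[l]}) (J : {set 'I_m}) : Prop :=
  (forall j, j \in J -> log_derivation alpha B (G j)) /\
  forall theta, log_derivation alpha B theta ->
    exists c : 'I_m -> {mpoly K[l]},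
      forall p, theta p = \sum_(j in J) c j * G j p.

Definition minimal_homog_generators (alpha : I -> 'rV[K]_l) (B : {set I})
    (m : nat) (G : 'I_m -> {mpoly K[l]} -> {mpoly K[l]}) : Prop :=
  [/\ forall j, exists d, homog_derivation d (G j),
      generates_log_der alpha B G [set: 'I_m]
    & forall J : {set 'I_m}, J \proper [set: 'I_m] ->
        ~ generates_log_der alpha B G J].

Definition max_generator_degree (alpha : I -> 'rV[K]_l) (B : {set I})
    (d : nat) : Prop :=
  exists m (G : 'I_m -> {mpoly K[l]} -> {mpoly K[l]}),
    minimal_homog_generators alpha B G /\ d = \max_(j < m) der_degree (G j).

End Arrangement.

(* Main.v *)
(* Let B be solvable in C and E be contained in the fibre C \ B. The forms v_i of
   E can be rescaled so that each difference v_i - v_j is a multiple of a form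
   of B. For theta in the module D of any arrangement containing B and E, the
   divided difference Z = sum_i (theta v_i / v_i) / prod_(j != i) (v_i - v_j) is
   then a polynomial of degree deg theta - |E|: in codimension one, along a
   hyperplane b of B, it only involves pencils of b, where
   theta v_i / v_i = u / v_i + h. Hence Z vanishes on D if D is generated in
   degrees < |E|. But Z is linear in theta and has a pole along each v_i for some
   constant derivation, so Z is nonzero on Q d/dx_m, which lies in D. Therefore
   some generator has degree >= |E|. Removing H from the last fibre only lowers
   |E| by one, and B need not change. *)
Require Import Defs.
From HB Require Import structures.
From mathcomp Require Import all_boot all_order all_algebra.
From mathcomp Require Import mpoly.
From mathcomp Require Import ring zify.

Set Implicit Arguments.
Unset Strict Implicit.
Unset Printing Implicit Defensive.

Import GRing.Theory.

Local Open Scope ring_scope.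

(** * Linear forms, and divisibility of polynomials by a linear form *)

Section LinearForms.

Variables (K : fieldType) (l : nat).
Implicit Types (a b v : 'rV[K]_l) (p q : {mpoly K[l]}).

Lemma linear_form_is_linear : linear (@linear_form K l).
Proof.
move=> c a b; rewrite /linear_form scaler_sumr -big_split /=.
by apply: eq_bigr => i _; rewrite !mxE scalerDl scalerA.
Qed.

HB.instance Definition _ :=
  GRing.isLinear.Build K 'rV[K]_l {mpoly K[l]} *:%R (@linear_form K l)
    linear_form_is_linear.

Lemma linear_form_mcoeff a i : (linear_form a)@_U_(i) = a 0 i.
Proof.
rewrite /linear_form raddf_sum /= (bigD1 i) //= mcoeffZ mcoeffXU eqxx mulr1.
by rewrite big1 ?addr0 // => j /negPf ji; rewrite mcoeffZ mcoeffXU ji mulr0.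
Qed.

Lemma linear_form_eq0 a : (linear_form a == 0) = (a == 0).
Proof.
apply/eqP/eqP => [a0|->]; last exact: linear0.
by apply/rowP => i; rewrite -linear_form_mcoeff a0 mcoeff0 mxE.
Qed.

Lemma linear_form_inj : injective (@linear_form K l).
Proof.
move=> a b /eqP.
by rewrite -subr_eq0 -linearB linear_form_eq0 subr_eq0 => /eqP.
Qed.

Lemma msize_linear_form a : a != 0 -> msize (linear_form a) = 2.
Proof.
move=> a0; have [i ai] := rV0Pn _ a0.
apply/eqP; rewrite eqn_leq; apply/andP; split.
  apply: leq_trans (msize_sum _ _ _) _; apply/bigmax_leqP => j _.
  by rewrite (leq_trans (msizeZ_le _ _)) // msizeX mdeg1.
have : U_(i)%MM \in msupp (linear_form a).
  by rewrite mcoeff_msupp linear_form_mcoeff.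
by move/msize_mdeg_lt; rewrite mdeg1.
Qed.

Definition lf_dvd b p := exists g, p = g * linear_form b.

Lemma lf_dvdD b p q : lf_dvd b p -> lf_dvd b q -> lf_dvd b (p + q).
Proof. by move=> [g ->] [h ->]; exists (g + h); rewrite mulrDl. Qed.

Lemma lf_dvdM b p q : lf_dvd b p -> lf_dvd b (q * p).
Proof. by move=> [g ->]; exists (q * g); rewrite mulrA. Qed.

Lemma lf_dvdZ b c p : lf_dvd b p -> lf_dvd b (c *: p).
Proof. by rewrite -mul_mpolyC; apply: lf_dvdM. Qed.

(* The retraction onto the hyperplane [b = 0] identifies the quotient by
   [linear_form b] with a subring of the polynomial ring; hence [linear_form b]
   is prime. *)
Lemma lf_retraction b : b != 0 ->
  exists s : {rmorphism {mpoly K[l]} -> {mpoly K[l]}},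
    (forall p, s p = 0 <-> lf_dvd b p) /\
    forall a, s (linear_form a) = 0 -> a \in <[b]>%VS.
Proof.
move=> /rV0Pn [m bm].
(* The projection onto the hyperplane along the [m]-th axis: only ['X_m] changes, by the multiple of
   the form that makes [linear_form b] go to zero. *)
pose x (i : 'I_l) : {mpoly K[l]} :=
  'X_i - ((i == m)%:R / b 0 m) *: linear_form b.
pose t := [tuple x i | i < l].
have tX i : 'X_i \mPo t = x i by rewrite comp_mpolyXU -tnth_nth tnth_mktuple.
have tlf a : linear_form a \mPo t = linear_form (a - (a 0 m / b 0 m) *: b).
  rewrite linearB linearZ /= {1}/linear_form linear_sum /=.
  transitivity (\sum_i (a 0 i *: 'X_i
      - (a 0 i * ((i == m)%:R / b 0 m)) *: linear_form b)).
    apply: eq_bigr => i _.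
    by rewrite linearZ /= tX /x scalerBr scalerA.
  rewrite sumrB; congr (_ - _); rewrite -scaler_suml; congr (_ *: _).
  rewrite (bigD1 m) //= eqxx mul1r big1 ?addr0 // => i /negPf ->.
  by rewrite mul0r mulr0.
exists (comp_mpoly t); split; last first.
  move=> a /=; rewrite tlf => /eqP; rewrite linear_form_eq0 subr_eq0 => /eqP ->.
  by rewrite memvZ ?memv_line.
(* The substitution is the identity modulo [linear_form b], because it is so on each variable. *)
have dvd_sub p : lf_dvd b (p - (p \mPo t)).
  elim/mpolyind: p => [|c u p _ _ IH].
    by rewrite linear0 subr0; exists 0; rewrite mul0r.
  rewrite linearD linearZ /= opprD addrACA -scalerBr.
  apply: lf_dvdD => //; apply: lf_dvdZ.
  rewrite mpolyXE_id rmorph_prod /=.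
  elim/big_ind2: _ => [|q1 p1 q2 p2 d1 d2|i _].
  - by exists 0; rewrite subrr mul0r.
  - have -> : p1 * p2 - q1 * q2 = p2 * (p1 - q1) + q1 * (p2 - q2) by ring.
    by apply: lf_dvdD; apply: lf_dvdM.
  rewrite rmorphXn /= tX; elim: (u i) => [|n IHn].
    by exists 0; rewrite subrr mul0r.
  have -> : 'X_i ^+ n.+1 - x i ^+ n.+1 =
      'X_i * ('X_i ^+ n - x i ^+ n) + x i ^+ n * ('X_i - x i).
    by rewrite !exprS; ring.
  apply: lf_dvdD; apply: lf_dvdM => //.
  by rewrite /x opprB addrC subrK; exists ((i == m)%:R / b 0 m)%:MP; rewrite mul_mpolyC.
move=> p; split => [p0|[g ->]].
  by have := dvd_sub p; rewrite p0 subr0.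
rewrite rmorphM /=. by rewrite tlf divff // scale1r subrr linear0 mulr0.
Qed.

Lemma lf_dvd1 b : b != 0 -> ~ lf_dvd b 1.
Proof.
by move=> /lf_retraction [s [sP _]] /sP /eqP; rewrite rmorph1 oner_eq0.
Qed.

Lemma lf_prime b p q : b != 0 -> lf_dvd b (p * q) -> lf_dvd b p \/ lf_dvd b q.
Proof.
move=> /lf_retraction [s [sP _]] /sP /eqP.
by rewrite rmorphM mulf_eq0 => /orP [] /eqP /sP; [left | right].
Qed.

Lemma lf_dvd_lf a b : b != 0 -> lf_dvd b (linear_form a) -> a \in <[b]>%VS.
Proof. by move=> /lf_retraction [s [sP sE]] /sP /sE. Qed.

Lemma lf_dvd_prod (J : finType) (P : pred J) b (G : J -> {mpoly K[l]}) :
  b != 0 -> lf_dvd b (\prod_(i | P i) G i) -> exists2 i, P i & lf_dvd b (G i).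
Proof.
move=> b0; elim/big_rec: _ => [|i p Pi IH /(lf_prime b0) [bG|/IH //]].
  by move/(lf_dvd1 b0).
by exists i.
Qed.

End LinearForms.

Lemma mulf_div_cancel (L : fieldType) (a b x : L) : a != 0 -> b != 0 ->
  a * b * (x / a / b) = x.
Proof. by move=> a0 b0; field; apply/andP. Qed.

(** * Divided differences over a field *)

Section DividedDifferences.

Variables (L : fieldType) (J : finType) (v : J -> L).
Implicit Types (w : J -> L) (E : {set J}).

(** The classical divided difference of the values [w] at the nodes [v], in Lagrange form: it is
    symmetric, so a set can index the nodes. *)
Definition divdiff w E : L :=
  \sum_(i in E) w i / \prod_(j in E :\ i) (v i - v j).

Lemma divdiff1 w i : divdiff w [set i] = w i.
Proof. by rewrite /divdiff big_set1 setDv big_set0 divr1. Qed.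

(** Bringing the sum back to the denominators of [E] lets [divdiff_rec] compare two such sums term
    by term. *)
Lemma divdiffD1 w E j : {in E &, injective v} -> j \in E ->
  divdiff w (E :\ j) =
  \sum_(k in E) w k * (v k - v j) / \prod_(i in E :\ k) (v k - v i).
Proof.
move=> vE jE; rewrite [RHS](big_setD1 j) //= subrr mulr0 mul0r add0r.
apply: eq_bigr => k /setD1P [kj kE].
have kjv : v k - v j != 0.
  by apply: contra_neq kj => /eqP; rewrite subr_eq0 => /eqP /vE; apply.
rewrite [X in _ = _ / X](big_setD1 j) /=; last by rewrite in_setD1 eq_sym kj.
have -> : E :\ k :\ j = E :\ j :\ k by rewrite !setDDl setUC.
by rewrite invfM mulrA mulfK.
Qed.

Lemma divdiff_rec w E i j : {in E &, injective v} -> i \in E -> j \in E ->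
  (v i - v j) * divdiff w E = divdiff w (E :\ j) - divdiff w (E :\ i).
Proof.
move=> vE iE jE; rewrite !divdiffD1 // -sumrB mulr_sumr.
by apply: eq_bigr => k _; rewrite -mulrBl mulrA; congr (_ / _); ring.
Qed.

(** The divided difference of a constant at two or more nodes is zero, and that of the function 1/x
    is, up to sign, the inverse of the product of the nodes. *)
Lemma divdiff_pencil u h w E : {in E &, injective v} ->
  {in E, forall i, v i != 0} -> {in E, forall i, w i = u / v i + h} ->
  (1 < #|E|)%N ->
  (\prod_(i in E) v i) * divdiff w E = (-1) ^+ #|E|.-1 * u.
Proof.
move=> vE v0 wE cE.
(* At a single node the constant [h] still contributes; it cancels at the first recursion step. *)
suff H n : forall F : {set J}, F \subset E -> #|F| = n.+1 ->
    (\prod_(i in F) v i) * divdiff w F =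
    (-1) ^+ n * u + (\prod_(i in F) v i) * (if n is 0 then h else 0).
  have [n cn] : exists n, #|E| = n.+2 by case: #|E| cE => [|[|n]] // _; exists n.
  by rewrite cn (H n.+1) // mulr0 addr0.
elim: n => [|n IH] F FE cF.
  have /cards1P [i iF] : #|F| == 1%N by rewrite cF.
  have iE : i \in E by apply: (subsetP FE); rewrite iF set11.
  by rewrite iF divdiff1 big_set1 wE // mul1r mulrDr mulrC divfK ?v0.
have /card_gt1P [i [j [iF jF ij]]] : (1 < #|F|)%N by rewrite cF.
have vF : {in F &, injective v} := sub_in2 (subsetP FE) vE.
have ijv : v i - v j != 0.
  by apply: contra_neq ij => /eqP; rewrite subr_eq0 => /eqP /vF; apply.
have cD x : x \in F -> #|F :\ x| = n.+1.
  by move=> xF; apply/eqP; rewrite -eqSS -cF (cardsD1 x F) xF.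
have sD x : F :\ x \subset E by apply: subset_trans (subsetDl _ _) FE.
have pD x : x \in F -> \prod_(k in F) v k = v x * \prod_(k in F :\ x) v k.
  by move=> xF; rewrite (big_setD1 x).
apply: (mulfI ijv); rewrite mulrCA divdiff_rec // mulrBr.
rewrite {1}(pD j) // (pD i) // -!mulrA !IH ?cD // !exprS !mulrDr !mulrA.
by rewrite -!pD //; ring.
Qed.

End DividedDifferences.

(** * Logarithmic derivations and their divided differences *)

Section LogDerivations.

Variables (K : fieldType) (l : nat) (I : finType).
Implicit Types (alpha v : I -> 'rV[K]_l) (theta : {mpoly K[l]} -> {mpoly K[l]}).

Local Notation "p %:F" := (@FracField.tofrac {mpoly K[l]} p).

Lemma derivation_linear_form theta a : derivation theta ->
  theta (linear_form a) = \sum_(m < l) a 0 m *: theta 'X_m.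
Proof.
move=> [lin _].
pose t : {linear {mpoly K[l]} -> {mpoly K[l]}} :=
  HB.pack theta (GRing.isLinear.Build _ _ _ _ theta lin).
rewrite -[theta]/(t : _ -> _) /linear_form linear_sum.
by apply: eq_bigr => m _; rewrite linearZ.
Qed.

Lemma derivation_linear_formB theta a b : derivation theta ->
  theta (linear_form (a - b)) = theta (linear_form a) - theta (linear_form b).
Proof.
move=> dt; rewrite !derivation_linear_form // -sumrB.
by apply: eq_bigr => m _; rewrite !mxE scalerBl.
Qed.

Lemma derivation_linear_formZ theta c a : derivation theta ->
  theta (linear_form (c *: a)) = c *: theta (linear_form a).
Proof.
move=> dt; rewrite !derivation_linear_form // scaler_sumr.
by apply: eq_bigr => m _; rewrite !mxE scalerA.
Qed.

Lemma msize_derivation_linear_form theta a d : derivation theta ->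
  (forall m : 'I_l, msize (theta 'X_m) <= d)%N ->
  (msize (theta (linear_form a)) <= d)%N.
Proof.
move=> dt td; rewrite derivation_linear_form //.
apply: leq_trans (msize_sum _ _ _) _; apply/bigmax_leqP => m _.
exact: leq_trans (msizeZ_le _ _) (td m).
Qed.

(** Eliminating [x] gives [p * z1 = z2 * linear_form b]; the form is prime and does not divide [p],
    so it divides [z1] and the denominator cancels. *)
Lemma frac_integral (b : 'rV[K]_l) (p z1 z2 : {mpoly K[l]}) x : b != 0 ->
  ~ lf_dvd b p -> (linear_form b)%:F * x = z1%:F -> p%:F * x = z2%:F ->
  exists z, x = z%:F.
Proof.
move=> b0 bp xz1 xz2.
have b0F : (linear_form b)%:F != 0 by rewrite tofrac_eq0 linear_form_eq0.
have : lf_dvd b (p * z1).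
  exists z2; apply/eqP; rewrite -tofrac_eq !tofracM -xz1 -xz2.
  by apply/eqP; ring.
case/(lf_prime b0) => // -[z zE]; exists z; apply: (mulfI b0F).
by rewrite xz1 zE tofracM mulrC.
Qed.

Lemma msize_mul_lf (a : 'rV[K]_l) (p : {mpoly K[l]}) d : a != 0 ->
  (msize (linear_form a * p) <= d.+1)%N -> (msize p <= d)%N.
Proof.
move=> a0; have [->|p0] := eqVneq p 0; first by rewrite msize0.
by rewrite msizeM ?linear_form_eq0 // msize_linear_form.
Qed.

(** The function Z of the opening idea, a priori only a rational function. *)
Definition theta_divdiff theta v (E : {set I}) : {fraction {mpoly K[l]}} :=
  divdiff (fun i => (linear_form (v i))%:F)
    (fun i => (theta (linear_form (v i)))%:F / (linear_form (v i))%:F) E.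

Lemma linear_form_frac_inj v (E : {set I}) : {in E &, injective v} ->
  {in E &, injective (fun i => (linear_form (v i))%:F)}.
Proof.
move=> vE i j iE jE /eqP; rewrite tofrac_eq => /eqP /linear_form_inj.
exact: vE.
Qed.

(** Induction on the size of [E]: the recursion makes [(v i - v j) * Z] polynomial for every pair,
    so a single linear denominator remains to be removed. The subtraction is truncated: for
    [d < #|E|] the bound says [z = 0]. *)
Lemma theta_divdiff_integral theta d alpha v (B E : {set I}) :
  derivation theta -> (forall m : 'I_l, msize (theta 'X_m) <= d.+1)%N ->
  {in E, forall i, v i != 0} ->
  {in E, forall i, lf_dvd (v i) (theta (linear_form (v i)))} ->
  {in B, forall x, alpha x != 0} ->
  {in B, forall x, lf_dvd (alpha x) (theta (linear_form (alpha x)))} ->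
  {in B & E, forall x i, v i \notin <[alpha x]>%VS} ->
  {in E &, injective v} ->
  {in E &, forall i j, i != j ->
     exists2 x, x \in B & v i - v j \in <[alpha x]>%VS} ->
  E != set0 ->
  exists2 z, theta_divdiff theta v E = z%:F & (msize z <= d.+1 - #|E|)%N.
Proof.
move=> dt td v0 vdvd a0 advd av vE vB.
move: {2}#|E| (erefl #|E|) => n; elim: n => [|n IH] in E v0 vdvd av vE vB *.
  by move=> /eqP; rewrite cards_eq0 => /eqP -> /eqP.
case: n IH => [|n] IH cE _.
  have /cards1P [i iF] : #|E| == 1%N by rewrite cE.
  have iE : i \in E by rewrite iF set11.
  have [g gE] := vdvd i iE; exists g.
    rewrite /theta_divdiff iF divdiff1 gE tofracM mulfK //.
    by rewrite tofrac_eq0 linear_form_eq0 v0.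
  rewrite cE subSS subn0; apply: (msize_mul_lf (v0 i iE)).
  by rewrite mulrC -gE msize_derivation_linear_form.
have VE := linear_form_frac_inj vE.
have recE i j : i \in E -> j \in E -> i != j ->
  exists2 z, (linear_form (v i - v j))%:F * theta_divdiff theta v E = z%:F
    & (msize z <= (d.+1 - #|E|).+1)%N.
  move=> iE jE ij.
  have step k : k \in E -> exists2 z, theta_divdiff theta v (E :\ k) = z%:F
      & (msize z <= d.+1 - n.+1)%N.
    move=> kE; have sE : {subset E :\ k <= E} by apply/subsetP/subsetDl.
    have cD : #|E :\ k| = n.+1 by apply/eqP; rewrite -eqSS -cE (cardsD1 k E) kE.
    rewrite -cD; apply: IH => //; try by move=> x /sE; auto.
    - by move=> x y xB /sE; exact: av.
    - exact: (sub_in2 sE vE).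
    - by move=> x y /sE xE /sE; exact: vB.
    - by rewrite -cards_eq0 cD.
  have [z1 E1 s1] := step j jE; have [z2 E2 s2] := step i iE.
  exists (z1 - z2).
    rewrite linearB !tofracB -E1 -E2; exact: divdiff_rec.
  have le : (d.+1 - n.+1 <= (d.+1 - #|E|).+1)%N.
    by rewrite cE !subSS subnS leqSpred.
  by apply: leq_trans (msizeD_le _ _) _; rewrite msizeN geq_max !(leq_trans _ le).
have [i [j [iE jE ij]]] : exists i, exists j, [/\ i \in E, j \in E & i != j].
  by apply/card_gt1P; rewrite cE.
have ij0 : v i - v j != 0.
  by rewrite subr_eq0; apply: contra_neq ij => /vE; apply.
have [zij Eij sij] := recE i j iE jE ij.
suff [z Ez] : exists z, theta_divdiff theta v E = z%:F.
  exists z => //; apply: (msize_mul_lf ij0); apply: leq_trans sij.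
  suff -> : linear_form (v i - v j) * z = zij by [].
  by apply/eqP; rewrite -tofrac_eq tofracM -Ez Eij.
have [x xB /vlineP [c cE']] := vB i j iE jE ij.
have c0 : c != 0 by apply: contra_neq ij0 => c0; rewrite cE' c0 scale0r.
have ijdvd a : lf_dvd (v i - v j) (linear_form a) -> a \in <[alpha x]>%VS.
  move/(lf_dvd_lf ij0); rewrite cE' => /vlineP [e ->].
  by rewrite scalerA memvZ ?memv_line.
(* Either some difference is not proportional to [alpha x] and supplies a second denominator prime
   to [v i - v j], or all nodes agree modulo [alpha x]. *)
have [/exists_inP [p pE /exists_inP [q qE pq]]|pencil] :=
    boolP [exists p in E, exists q in E, (v p - v q) \notin <[alpha x]>%VS].
  have pq' : p != q by apply: contraNneq pq => ->; rewrite subrr mem0v.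
  have [zpq Epq _] := recE p q pE qE pq'.
  apply: frac_integral Eij Epq => // /ijdvd; exact/negP.
have {}pencil p q : p \in E -> q \in E -> v p - v q \in <[alpha x]>%VS.
  move=> pE qE; apply: contraNT pencil => pq.
  by apply/exists_inP; exists p => //; apply/exists_inP; exists q.
(* As [theta] multiplies [alpha x], hence every difference of nodes, by [h], the polynomial
   [theta v_p - h v_p] does not depend on [p]; it is [u]. *)
have [h hE] := advd x xB.
pose u := theta (linear_form (v i)) - h * linear_form (v i).
have uE p : p \in E -> theta (linear_form (v p)) = u + h * linear_form (v p).
  move=> pE; have /vlineP [e eE] := pencil _ _ pE iE.
  have : theta (linear_form (v p - v i)) = h * linear_form (v p - v i).
    by rewrite eE derivation_linear_formZ // hE linearZ scalerAr.
  rewrite derivation_linear_formB // linearB /u => /eqP.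
  rewrite subr_eq => /eqP ->; ring.
(* The pencil formula has the product of the nodes as denominator, and [v i - v j] divides none of
   them. *)
apply: (frac_integral ij0 _ Eij
  (p := \prod_(p in E) linear_form (v p)) (z2 := (-1) ^+ #|E|.-1 * u)).
  move/(lf_dvd_prod ij0) => [p pE /ijdvd]; apply/negP; exact: av.
rewrite rmorph_prod /= (@divdiff_pencil _ _ _ u%:F h%:F) //.
- by rewrite tofracM rmorphXn rmorphN1.
- by move=> p pE; rewrite tofrac_eq0 linear_form_eq0 v0.
- move=> p pE; rewrite uE // tofracD tofracM mulrDl mulfK //.
  by rewrite tofrac_eq0 linear_form_eq0 v0.
- by rewrite cE.
Qed.

Lemma theta_divdiff_sum theta v (E : {set I}) m
    (c : 'I_m -> {mpoly K[l]}) (G : 'I_m -> {mpoly K[l]} -> {mpoly K[l]}) :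
  (forall p, theta p = \sum_(j < m) c j * G j p) ->
  theta_divdiff theta v E = \sum_(j < m) (c j)%:F * theta_divdiff (G j) v E.
Proof.
move=> tE; rewrite /theta_divdiff /divdiff.
under [RHS]eq_bigr => j _ do rewrite mulr_sumr.
rewrite exchange_big /=; apply: eq_bigr => i _.
rewrite tE rmorph_sum /= !mulr_suml; apply: eq_bigr => j _.
by rewrite tofracM !mulrA.
Qed.

Lemma theta_divdiff_mul q theta v (E : {set I}) :
  theta_divdiff (fun p => q * theta p) v E = q%:F * theta_divdiff theta v E.
Proof.
rewrite /theta_divdiff /divdiff mulr_sumr.
by apply: eq_bigr => i _; rewrite tofracM !mulrA.
Qed.

Lemma mderiv_derivation (m : 'I_l) : derivation (@mderiv l K m).
Proof. by split; [exact: linearP | exact: mderivM]. Qed.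

Lemma mderiv_linear_form m (a : 'rV[K]_l) : (linear_form a)^`M(m) = (a 0 m)%:MP.
Proof.
rewrite derivation_linear_form; last exact: mderiv_derivation.
rewrite (bigD1 m) //= big1 => [|k /negPf km].
  rewrite addr0 mderivX mnm1E eqxx scale1r.
  have -> : (U_(m) - U_(m))%MM = 0%MM :> 'X_{1.. l}.
    by apply/mnmP => k; rewrite mnmBE subnn mnm0E.
  by rewrite mpolyX0 alg_mpolyC.
by rewrite mderivX mnm1E km scale0r scaler0.
Qed.

(* Membership in the localization at the prime ideal generated by [b]. *)
Definition lf_local (b : 'rV[K]_l) (x : {fraction {mpoly K[l]}}) :=
  exists p q, ~ lf_dvd b p /\ p%:F * x = q%:F.

Lemma lf_localD b x y : b != 0 -> lf_local b x -> lf_local b y -> lf_local b (x + y).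
Proof.
move=> b0 [p [q [bp E]]] [p' [q' [bp' E']]]; exists (p * p'), (q * p' + q' * p).
split; first by case/(lf_prime b0).
by rewrite tofracD !tofracM -E -E'; ring.
Qed.

(** The choice of [m] makes the derivative of [v i] a nonzero constant, which cannot cancel the
    denominator [v i] of its term. *)
Lemma theta_divdiff_mderiv_neq0 v (E : {set I}) i m :
  i \in E -> v i 0 m != 0 -> {in E, forall k, k != i -> v k \notin <[v i]>%VS} ->
  {in E &, forall j k, j != k -> v j - v k \notin <[v i]>%VS} ->
  theta_divdiff (@mderiv l K m) v E != 0.
Proof.
move=> iE vim vN vBN.
have vi0 : v i != 0 by apply: contraNneq vim => ->; rewrite mxE.
have lfN a : a \notin <[v i]>%VS -> ~ lf_dvd (v i) (linear_form a).
  by move=> aN /(lf_dvd_lf vi0); apply/negP.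
pose P k := \prod_(j in E :\ k) (linear_form (v k) - linear_form (v j)).
have prodN k : k \in E -> ~ lf_dvd (v i) (P k).
  move=> kE /(lf_dvd_prod vi0) [j /setD1P [jk jE]]; rewrite -linearB.
  by apply/lfN/vBN; rewrite // eq_sym.
have tofrac_prod k : (P k)%:F =
    \prod_(j in E :\ k) ((linear_form (v k))%:F - (linear_form (v j))%:F).
  by rewrite rmorph_prod /=; apply: eq_bigr => j _; rewrite tofracB.
have neq0 p : ~ lf_dvd (v i) p -> p%:F != 0.
  move=> pN; rewrite tofrac_eq0; apply/eqP => p0; apply: pN.
  by exists 0; rewrite mul0r.
rewrite /theta_divdiff /divdiff (big_setD1 i) //= addr_eq0.
(* Among the terms of the sum, only the [i]-th one has a pole along [v i]. *)
set R := \sum_(k in _) _; apply/eqP => iR.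
have [p [q [pN pq]]] : lf_local (v i) R.
  rewrite /R; elim/big_ind: _ => [|x y|k /setD1P [ki kE]].
  - exists 1, 0; rewrite tofrac0 mulr0; by split=> //; apply: lf_dvd1.
  - exact: lf_localD.
  exists (linear_form (v k) * P k).
  exists ((linear_form (v k))^`M(m)); split.
    by case/(lf_prime vi0); [apply/lfN/vN | apply: prodN].
  rewrite -tofrac_prod tofracM.
  have h1 := neq0 _ (prodN k kE); have h2 := neq0 _ (lfN _ (vN k kE ki)).
  move: h1 h2; set x := _%:F; set y := _%:F; set z := _%:F => h1 h2.
  exact: (@mulf_div_cancel {fraction {mpoly K[l]}} y x z h2 h1).
(* Clearing denominators in the equality of the [i]-th term with [- R] gives
   [v_i(m) p = - v_i P_i q], so [v i] would divide [p]. *)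
apply: pN; exists (- (v i 0 m)^-1%:MP * q * P i).
have h1 := neq0 _ (prodN i iE).
have h2 : (linear_form (v i))%:F != 0 by rewrite tofrac_eq0 linear_form_eq0.
have {}iR : ((v i 0 m)%:MP : {mpoly K[l]})%:F =
   - ((linear_form (v i))%:F * (P i)%:F * R).
  rewrite -mderiv_linear_form -mulrN -iR -tofrac_prod.
  move: h1 h2; set x := _%:F; set y := _%:F; set z := _%:F => h1 h2.
  exact/esym/(@mulf_div_cancel {fraction {mpoly K[l]}} y x z h2 h1).
have cK : (v i 0 m)^-1%:MP * (v i 0 m)%:MP = 1 :> {mpoly K[l]}.
  by rewrite -mpolyCM mulVf.
have {}iR : (v i 0 m)%:MP * p =
    - (linear_form (v i) * P i * q).
  apply/eqP; rewrite -tofrac_eq tofracN !tofracM iR -pq; apply/eqP.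
  by rewrite mulNr -!mulrA [R * _]mulrC.
by rewrite -[LHS]mul1r -[X in X * p]cK -[LHS]mulrA iR; ring.
Qed.

Lemma alpha_vline alpha : is_arrangement alpha ->
  forall i j, alpha i \in <[alpha j]>%VS -> i = j.
Proof.
move=> [a0 inj] i j /vlineP [c ac]; apply: inj; rewrite /= ac.
have c0 : c != 0 by apply: contraNneq (a0 i) => c0; rewrite ac c0 scale0r.
apply/vspaceP => x; rewrite !memv_ker !lfunE /= linearZ /= -scalemxAr.
by rewrite scaler_eq0 (negPf c0).
Qed.

(** By the Leibniz rule, [theta (alpha i)] times the product of the other forms vanishes modulo
    [alpha i], and that product is prime to [alpha i] because the hyperplanes are distinct. *)
Lemma log_derivation_dvd alpha (C : {set I}) theta i : is_arrangement alpha ->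
  log_derivation alpha C theta -> i \in C ->
  lf_dvd (alpha i) (theta (linear_form (alpha i))).
Proof.
move=> arr [[_ leib] [g]]; rewrite /defining_poly => tQ iC.
have [a0 _] := arr; move: tQ; rewrite (big_setD1 i) //= leib => tQ.
set P := \prod_(j in _) _ in tQ.
have : lf_dvd (alpha i) (theta (linear_form (alpha i)) * P).
  exists (g * P - theta P); rewrite mulrBl.
  by apply/eqP; rewrite eq_sym subr_eq; apply/eqP; rewrite [theta P * _]mulrC tQ; ring.
case/(lf_prime (a0 i)) => // /(lf_dvd_prod (a0 i)) [j /setD1P [ji _]].
by move/(lf_dvd_lf (a0 i))/(alpha_vline arr) => ij; rewrite ij eqxx in ji.
Qed.

Lemma mderiv_log_derivation alpha (C : {set I}) m :
  log_derivation alpha C (fun p => defining_poly alpha C * p^`M(m)).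
Proof.
split; last by exists ((defining_poly alpha C)^`M(m)); rewrite mulrC.
split=> [c p q|p q]; first by rewrite linearP mulrDr scalerAr.
by rewrite mderivM; ring.
Qed.

(** Linearity of Z over polynomials carries its vanishing from the generators to the whole module,
    which the multiple by Q of a partial derivative contradicts. Leaving [C] free serves the
    arrangements with and without [H] alike. *)
Lemma max_generator_degree_ge alpha v (B C E : {set I}) d :
  is_arrangement alpha -> B \subset C -> E \subset C -> [disjoint B & E] ->
  {in E, forall i, exists2 c, c != 0 & v i = c *: alpha i} ->
  {in E &, forall i j, i != j ->
     exists2 x, x \in B & v i - v j \in <[alpha x]>%VS} ->
  max_generator_degree alpha C d -> (#|E| <= d)%N.
Proof.
move=> arr BC EC BE vE vB [n [G [[_ [Glog Ggen] _] dE]]].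
have [a0 _] := arr; have aN := alpha_vline arr.
have [->|[i iE]] := set_0Vmem E; first by rewrite cards0.
have v0 k : k \in E -> v k != 0.
  by move=> /vE [c c0 ->]; rewrite scaler_eq0 negb_or c0 a0.
have lineE k : k \in E -> (<[v k]> = <[alpha k]>)%VS.
  move=> /vE [c c0 ->]; apply/eqP; rewrite eqEsubv -!memvE.
  rewrite memvZ ?memv_line //= -[X in X \in _](scalerK c0).
  by rewrite memvZ ?memv_line.
have mem_v k (U : {vspace 'rV[K]_l}) : k \in E -> (v k \in U) = (alpha k \in U).
  by move=> kE; rewrite !memvE lineE.
have vN : {in E, forall k, k != i -> v k \notin <[v i]>%VS}.
  move=> k kE ki; rewrite lineE // mem_v //.
  by apply: contra_neqN ki => /aN.
have BEN x k : x \in B -> k \in E -> x != k.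
  by move=> xB kE; apply: contraTneq xB => ->; rewrite (disjointFl BE).
have vinj : {in E &, injective v}.
  by move=> j k jE kE jk; apply: aN; rewrite -mem_v // jk mem_v // memv_line.
have vBN : {in E &, forall j k, j != k -> v j - v k \notin <[v i]>%VS}.
  move=> j k jE kE jk; have [x xB /vlineP [c cE]] := vB j k jE kE jk.
  have c0 : c != 0.
    apply: contra_neq jk => c0; apply: vinj => //; apply/eqP.
    by rewrite -subr_eq0 cE c0 scale0r.
  apply: contra_neqN (BEN x i xB iE); rewrite lineE // => h; apply: aN.
  by rewrite -(scalerK c0 (alpha x)) -cE memvZ.
rewrite leqNgt; apply/negP => ltd.
(* Under [d < #|E|] the size bound [d.+1 - #|E|] is zero for every generator. *)
have G0 j : theta_divdiff (G j) v E = 0.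
  have [Gd _] := Glog j (in_setT j).
  have Gdvd k (kC : k \in C) := log_derivation_dvd arr (Glog j (in_setT j)) kC.
  case: (@theta_divdiff_integral (G j) d alpha v B E) => //.
  - move=> m; have : (der_degree (G j) <= d)%N by rewrite dE (leq_bigmax j).
    move/bigmax_leqP => /(_ m isT); lia.
  - move=> k kE; have [c c0 ->] := vE k kE.
    have [g gE] := Gdvd k (subsetP EC k kE); exists g.
    by rewrite derivation_linear_formZ // gE linearZ scalerAr.
  - by move=> x xB; apply/Gdvd/(subsetP BC).
  - move=> x k xB kE; rewrite mem_v //; apply: contra_neqN (BEN x k xB kE).
    by move/aN.
  - by apply/set0Pn; exists i.
  move=> z -> sz; suff -> : z = 0 by rewrite tofrac0.
  by apply/eqP; rewrite -msize_poly_eq0; lia.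
have /rV0Pn [m vim] := v0 i iE.
have [c cE] := Ggen _ (mderiv_log_derivation alpha C m).
have := theta_divdiff_mderiv_neq0 iE vim vN vBN; apply/negP/negPn.
have Q0 : (defining_poly alpha C)%:F != 0.
  rewrite tofrac_eq0; apply/prodf_neq0 => k _; by rewrite linear_form_eq0.
rewrite -(mulrI_eq0 _ (mulfI Q0)) -theta_divdiff_mul.
rewrite (@theta_divdiff_sum _ v E _ c G) => [|p]; last first.
  by rewrite cE; apply: eq_bigl => j; rewrite inE.
by rewrite big1 // => j _; rewrite G0 mulr0.
Qed.

End LogDerivations.

(** * Ranks of triples of hyperplanes and the rescaling of a fibre *)

Section Rank.

Variables (K : fieldType) (l : nat) (I : finType) (alpha : I -> 'rV[K]_l).
Hypothesis arr : is_arrangement alpha.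

Lemma mem_hyperplane (a u : 'rV[K]_l) : (u \in hyperplane a) = (u *m a^T == 0).
Proof. by rewrite memv_ker lfunE. Qed.

(** Linear duality: the columns of the cokernel matrix are killed by [a] and [b], hence by [x],
    which puts [x] in the row space of the other two. *)
Lemma hyperplane_cap_sub (a b x : 'rV[K]_l) :
  (hyperplane a :&: hyperplane b <= hyperplane x)%VS ->
  exists s t, x = s *: a + t *: b.
Proof.
move=> /subvP sub; pose C := cokermx (col_mx a b).
have : col_mx a b *m C = 0 by apply: mulmx_coker.
rewrite mul_col_mx => /eqP; rewrite col_mx_eq0 => /andP [/eqP aC /eqP bC].
have colC (u : 'rV[K]_l) j : u *m C = 0 -> (col j C)^T *m u^T = 0.
  by move=> uC; rewrite -trmx_mul colE mulmxA uC mul0mx trmx0.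
have /submxP [D ->] : (x <= col_mx a b)%MS.
  rewrite submxE; apply/eqP/matrixP => i j.
  have : (col j C)^T \in hyperplane x.
    by apply: sub; rewrite memv_cap !mem_hyperplane !colC ?eqxx.
  rewrite mem_hyperplane -trmx_mul colE mulmxA -colE => /eqP /matrixP /(_ 0 i).
  by rewrite !mxE.
exists (lsubmx D 0 0), (rsubmx D 0 0).
rewrite -{1}[D]hsubmxK mul_row_col.
by rewrite {1}[lsubmx D]mx11_scalar {1}[rsubmx D]mx11_scalar !mul_scalar_mx.
Qed.

Lemma dim_cap_hyperplane (U : {vspace 'rV[K]_l}) a :
  (\dim U <= (\dim (U :&: hyperplane a)).+1)%N.
Proof.
rewrite -(limg_ker_dim (linfun (mulmxr a^T : 'rV[K]_l -> 'rV[K]_1)) U).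
rewrite -[X in (_ <= X)%N]addn1 leq_add2l.
by rewrite (leq_trans (dimvS (subvf _))) // dimvf /dim /= mul1n.
Qed.

Lemma dim_hyperplane (a : 'rV[K]_l) : a != 0 -> (\dim (hyperplane a)).+1 = l.
Proof.
have dl : \dim {: 'rV[K]_l} = l by rewrite dimvf /dim /= mul1n.
move=> /rV0Pn [i ai]; apply/eqP; rewrite eqn_leq; apply/andP; split; last first.
  by rewrite -{1}dl; have := dim_cap_hyperplane fullv a; rewrite capfv.
rewrite -[X in (_ <= X)%N]dl ltn_neqAle dimvS ?subvf // andbT.
apply: contraNneq ai => /eqP; rewrite (dimv_leqif_eq (subvf _)) => /eqP full.
have : delta_mx 0 i \in hyperplane a by rewrite full memvf.
rewrite mem_hyperplane -rowE => /eqP /matrixP /(_ 0 0); rewrite !mxE => ->.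
exact: eqxx.
Qed.

Lemma dim_cap2_hyperplane x y : x != y ->
  (\dim (hyperplane (alpha x) :&: hyperplane (alpha y))).+2 = l.
Proof.
have [a0 inj] := arr; move=> xy; apply/eqP; rewrite eqn_leq; apply/andP; split.
  rewrite -[X in (_ <= X)%N](dim_hyperplane (a0 x)) ltnS ltn_neqAle.
  rewrite dimvS ?capvSl // andbT; apply: contraNneq xy => /eqP.
  rewrite (dimv_leqif_eq (capvSl _ _)) => /eqP /capv_idPl sxy.
  apply/eqP/inj/eqP; rewrite -(dimv_leqif_eq sxy).
  by rewrite -eqSS !dim_hyperplane.
by rewrite -[X in (X <= _)%N](dim_hyperplane (a0 x)) ltnS dim_cap_hyperplane.
Qed.

(** Two distinct hyperplanes already meet in codimension 2, so everything depends on whether the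
    third contains their intersection. *)
Lemma arr_rank_le2P x y z : x != y ->
  (arr_rank alpha [set x; y; z] <= 2)%N <->
  exists s t, alpha z = s *: alpha x + t *: alpha y.
Proof.
move=> xy; have dxy := dim_cap2_hyperplane xy.
rewrite /arr_rank; set W := (\bigcap_(i in _) _)%VS.
set U := (_ :&: _)%VS in dxy.
have WS i : i \in [set x; y; z] -> (W <= hyperplane (alpha i))%VS.
  by move=> iS; apply: bigcapv_inf iS _.
have WU : (W <= U)%VS by rewrite subv_cap !WS // !inE eqxx ?orbT.
split=> [dW|[s [t zE]]].
  apply: hyperplane_cap_sub.
  have -> : (hyperplane (alpha x) :&: hyperplane (alpha y) = W)%VS.
    apply/esym/eqP; rewrite -(dimv_leqif_eq WU) eqn_leq dimvS //=; lia.
  by apply: WS; rewrite !inE eqxx orbT.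
suff UW : (U <= W)%VS by have := dimvS UW; lia.
apply/subv_bigcapP => i; rewrite !inE -orbA => /or3P [] /eqP ->.
- exact: capvSl.
- exact: capvSr.
apply/subvP => u; rewrite memv_cap !mem_hyperplane zE => /andP [/eqP ux /eqP uy].
by rewrite linearD !linearZ /= mulmxDr -!scalemxAr ux uy !scaler0 addr0.
Qed.

(* The scaling is normalized against a fixed element e of the fibre; condition
   (3) then extends the property from pairs containing e to all pairs. *)
Lemma solvable_in_scaling (B C : {set I}) : solvable_in alpha B C ->
  exists v : I -> 'rV[K]_l,
    (forall i, exists2 c, c != 0 & v i = c *: alpha i) /\
    {in C :\: B &, forall i j, i != j ->
       exists2 x, x \in B & v i - v j \in <[alpha x]>%VS}.
Proof.
move=> [BC h1 h2 h3]; have [a0 _] := arr; have aN := alpha_vline arr.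
have [E0|[e eE]] := set_0Vmem (C :\: B).
  exists alpha; split=> [i|i j]; first by exists 1; rewrite ?oner_eq0 ?scale1r.
  by rewrite E0 inE.
have BE x i : x \in B -> i \in C :\: B -> x != i.
  by move=> xB; rewrite inE => /andP [iB _]; apply: contraNneq iB => <-.
have codepE a b x : a != b -> codep alpha B a b x ->
    exists s t, alpha x = s *: alpha a + t *: alpha b.
  by move=> ab [_ rk]; apply/arr_rank_le2P; rewrite ?rk.
(* The scalars are normalized to 1 at [e], and set to 1 by default outside the fibre. *)
have ch i : exists c, [/\ c != 0, i = e -> c = 1 & i \in C :\: B -> i != e ->
    exists2 x, codep alpha B e i x & alpha e - c *: alpha i \in <[alpha x]>%VS].
  have [->|ie] := eqVneq i e; first by exists 1; split; rewrite ?oner_eq0.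
  have [iE|iE] := boolP (i \in C :\: B); last by exists 1; split; rewrite ?oner_eq0.
  have ei : e != i by rewrite eq_sym.
  have [x cx] := h2 e i eE iE ei; have [s [t xE]] := codepE e i x ei cx.
  have [xB _] := cx.
  have s0 : s != 0.
    apply: contra_neq (BE x i xB iE) => s0; apply: aN.
    by rewrite xE s0 scale0r add0r memvZ ?memv_line.
  have t0 : t != 0.
    apply: contra_neq (BE x e xB eE) => t0; apply: aN.
    by rewrite xE t0 scale0r addr0 memvZ ?memv_line.
  (* The scalar is read off from [alpha x = s *: alpha e + t *: alpha i] divided by [s]. *)
  exists (- (s^-1 * t)); split; first by rewrite oppr_eq0 mulf_neq0 ?invr_eq0.
    by move=> ie'; rewrite ie' eqxx in ie.
  move=> _ _; exists x => //; rewrite scaleNr opprK -scalerA -[alpha e](scalerK s0).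
  by rewrite -scalerDr -xE memvZ ?memv_line.
have [c cP] := fin_all_exists ch; exists (fun i => c i *: alpha i).
split=> [i|i j iE jE ij]; first by exists (c i) => //; have [] := cP i.
have ce : c e = 1 by have [_ ->] := cP e.
have [ie|ie] := eqVneq i e.
  have [_ _] := cP j; rewrite -ie eq_sym => /(_ jE ij) [x [xB _] xj].
  by exists x; rewrite // ie ce scale1r -ie.
have [je|je] := eqVneq j e.
  have cj : c j = 1 by rewrite je.
  have [_ _] := cP i; rewrite -je => /(_ iE ij) [x [xB _] xi].
  by exists x; rewrite // -memvN opprB cj scale1r.
have [ci0 _ /(_ iE ie) [x cx /vlineP [f fE]]] := cP i.
have [cj0 _ /(_ jE je) [y cy /vlineP [g gE]]] := cP j.
have [xB _] := cx; have [yB _] := cy.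
have diff : c i *: alpha i - c j *: alpha j = g *: alpha y - f *: alpha x.
  by rewrite -fE -gE opprB [RHS]addrC addrA subrK.
have [xy|xy] := eqVneq x y.
  by exists x; rewrite // diff -xy -scalerBl memvZ ?memv_line.
have [z cz] := h2 i j iE jE ij; have [zB _] := cz; exists z => //.
have [p [q zE]] := codepE i j z ij cz.
(* Condition (3) bounds the rank of the three values of f by 2. *)
have [s [t zE']] : exists s t, alpha z = s *: alpha x + t *: alpha y.
  apply/arr_rank_le2P => //.
  have ei : e != i by rewrite eq_sym.
  have ej : e != j by rewrite eq_sym.
  by have [|] := h3 e i j eE iE jE ei ej ij x y z cx cy cz => ->.
pose p' := p / c i; pose q' := q / c j.
have {}zE : alpha z = p' *: (c i *: alpha i) + q' *: (c j *: alpha j).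
  by rewrite !scalerA !divfK.
have iX : c i *: alpha i = alpha e - f *: alpha x by rewrite -fE opprB addrC subrK.
have jX : c j *: alpha j = alpha e - g *: alpha y by rewrite -gE opprB addrC subrK.
(* Modulo the span of [alpha x] and [alpha y], both rescaled forms equal [alpha e] and [alpha z] is
   zero. A nonzero [p' + q'] would put [alpha e] in that span, against the rank 3 of condition
   (1). *)
have pq : p' + q' = 0.
  apply/eqP; apply: contra_eqT (h1 x y e xB yB xy eE) => pq.
  suff /(arr_rank_le2P e xy) : exists s t, alpha e = s *: alpha x + t *: alpha y.
    by apply: contraTneq => ->.
  exists ((p' + q')^-1 * (s + p' * f)), ((p' + q')^-1 * (t + q' * g)).
  rewrite -!(scalerA (p' + q')^-1) -scalerDr -[LHS](scalerK pq); congr (_ *: _).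
  have : p' *: (alpha e - f *: alpha x) + q' *: (alpha e - g *: alpha y) =
         s *: alpha x + t *: alpha y by rewrite -iX -jX -zE.
  rewrite !scalerBr !scalerA !scalerDl => H.
  rewrite [s *: _ + _]addrC [t *: _ + _]addrC addrACA -H.
  by rewrite addrCA !addrA; apply/rowP => k; rewrite !mxE; ring.
have p0 : p' != 0.
  apply: contraNneq (a0 z) => p0; move: pq; rewrite zE p0 add0r => ->.
  by rewrite !scale0r addr0.
move: zE; have -> : q' = - p' by apply/eqP; rewrite -addr_eq0 addrC pq.
rewrite scaleNr -scalerBr => zE.
by rewrite -[X in X \in _](scalerK p0) -zE memvZ ?memv_line.
Qed.

End Rank.

(** * The degree bound along a solvable filtration *)

Theorem theorem5p9 (K : fieldType) (charK : [pchar K] =i pred0) (l : nat)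
  (I : finType) (alpha : I -> 'rV[K]_l) (harr : is_arrangement alpha)
  (k : nat) (F : nat -> {set I}) (hF : solvable_filtration alpha k F)
  (H : I) (hH : H \in [set: I] :\: F k.-1)
  (dA' dA : nat)
  (hdA' : max_generator_degree alpha ([set: I] :\ H) dA')
  (hdA : max_generator_degree alpha [set: I] dA) :
  (max_hyperexponent k F - 1 <= dA')%N /\ (max_hyperexponent k F - 1 <= dA)%N.
Proof.
have [F0 _ Fs F1 Fsolv] := hF.
have Fmono i j : (i <= j <= k)%N -> F i \subset F j.
  move=> /andP []; elim: j => [|j IH]; first by rewrite leqn0 => /eqP ->.
  rewrite leq_eqVlt => /predU1P [-> //|ij jk].
  exact: subset_trans (IH ij (ltnW jk)) (proper_sub (Fs j jk)).
(* Both arrangements contain every hyperplane other than [H], so one argument covers them. *)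
suff main (C : {set I}) d : [set: I] :\ H \subset C -> max_generator_degree alpha C d ->
    (max_hyperexponent k F - 1 <= d)%N.
  by split; [apply: main hdA' | apply: main hdA; apply: subsetT].
move=> HC hd; rewrite leq_subLR /max_hyperexponent.
apply/bigmax_leqP_seq => i; rewrite mem_index_iota => /andP [i0 ik] _.
rewrite /hyperexponent; case: i i0 ik => // -[|i] _ ik.
  (* The first hyperexponent is 1, for which the bound is trivial. *)
  by rewrite F0 setD0 F1 ?ltn_addr.
have [v [vE vB]] := solvable_in_scaling harr (Fsolv i.+1 ik).
pose E := (F i.+2 :\: F i.+1) :\ H.
have EF : {subset E <= F i.+2 :\: F i.+1} by apply/subsetP/subsetDl.
(* At most [H] is lost from the fibre, whence the [- 1] of the bound. *)
apply: (@leq_trans #|E|.+1).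
  by rewrite (cardsD1 H) -/E -[#|E|.+1]add1n leq_add2r leq_b1.
rewrite add1n ltnS; apply: (max_generator_degree_ge (v := v) (B := F i.+1) harr) hd.
(* Since [i.+1 < k], the set [F i.+1] lies in [F k.-1] and so avoids [H]. *)
- apply: subset_trans HC; rewrite subsetD1 subsetT /=.
  move: hH; rewrite inE => /andP [HF _]; apply: contra HF; apply/subsetP/Fmono.
  by case: (k) ik => // k'; rewrite ltnS leqnSn andbT.
- by apply: subset_trans HC; rewrite setSD ?subsetT.
- rewrite disjoint_sym -setI_eq0 -subset0; apply/subsetP => x.
  by rewrite !inE => /andP [/and3P [_ /negPf ->]].
- by move=> x _; apply: vE.
- by move=> x y /EF xE /EF yE; apply: vB.
Qed.
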